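(* Let $n\ge 1$, $V=\{1,\dots,n\}$, and let $\mathcal H\subseteq 2^V$ be a symmetric hypergraph (with $\mathcal H\neq\emptyset$ and $\emptyset\notin\mathcal H$). Then $\mathcal H$ is a JM hypergraph if and only if $\mathcal H$ is minimal transversal-free and $n\ge 3$.
   Context: Hypergraph NIM: given $\mathcal H\subseteq 2^V$ with $\mathcal H\neq\emptyset$, $\emptyset\notin\mathcal H$, positions are vectors $x\in\mathbb Z_{\ge 0}^V$ ($x_i$ = number of stones in pile $i$). A move $x\to x'$ consists of choosing $H\in\mathcal H$ and strictly decreasing every coordinate $x_i$, $i\in H$ (to any nonnegative values), leaving the others unchanged; i.e. $\{i: x'_i<x_i\}\in\mathcal H$ and $x'_i\le x_i$ for all $i$. Two players alternate; the player unable to move loses. This game is $NIM_{\mathcal H}$. Its Sprague–Grundy function is $\mathcal G_{\mathcal H}(x)=\mathrm{mex}\{\mathcal G_{\mathcal H}(x'): x\to x'\}$, where $\mathrm{mex}(S)$ is the least nonnegative integer not in $S$. The Tetris value $\mathcal T_{\mathcal H}(x)$ is the maximum number of consecutive moves that can be made in $NIM_{\mathcal H}$ starting from $x$ (equivalently, the maximum length of a sequence of moves each of which decreases the coordinates of some hyperedge by exactly 1). Let $e$ be the all-ones vector and define $m(x)=\min_{i\in V}x_i$, $y_{\mathcal H}(x)=\mathcal T_{\mathcal H}(x-m(x)e)+1$, $v_{\mathcal H}(x)=\binom{y_{\mathcal H}(x)}{2}+\left(\left(m(x)-\binom{y_{\mathcal H}(x)}{2}-1\right)\bmod y_{\mathcal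 H}(x)\right)$, and $\mathcal U_{\mathcal H}(x)=\mathcal T_{\mathcal H}(x)$ if $m(x)\le\binom{y_{\mathcal H}(x)}{2}$, and $\mathcal U_{\mathcal H}(x)=v_{\mathcal H}(x)$ otherwise. $\mathcal H$ is called JM if $\mathcal G_{\mathcal H}(x)=\mathcal U_{\mathcal H}(x)$ for all $x\in\mathbb Z_{\ge0}^V$. $\mathcal H$ is symmetric if $H\in\mathcal H$ implies every subset of $V$ of size $|H|$ is in $\mathcal H$. A set $T\subseteq V$ is a transversal of $\mathcal H$ if $T\cap H\neq\emptyset$ for all $H\in\mathcal H$. $\mathcal H$ is transversal-free if no hyperedge $H\in\mathcal H$ is a transversal of $\mathcal H$. For $S\subseteq V$, the induced subhypergraph is $\mathcal H_S=\{H\in\mathcal H: H\subseteq S\}$. $\mathcal H$ is minimal transversal-free if it is transversal-free and every nonempty proper induced subhypergraph $\mathcal H_S$ ($S\subsetneq V$, $\mathcal H_S\ne\emptyset$) is not transversal-free. *)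

(* Defs.v *)
From mathcomp Require Import all_boot.

Set Implicit Arguments.
Unset Strict Implicit.
Unset Printing Implicit Defensive.

Definition mex (s : seq nat) : nat :=
  find (fun k => k \notin s) (iota 0 (size s).+1).

Lemma mexP (s : seq nat) :
  mex s \notin s /\ forall k, k < mex s -> k \in s.
Proof.
rewrite /mex; set p := fun k => _; set r := iota _ _.
have hasp : has p r.
  apply/negPn; rewrite -all_predC; apply/negP => /allP sub.
  have /(uniq_leq_size (iota_uniq 0 (size s).+1)) : {subset r <= s}.
    by move=> k /sub; rewrite /= negbK.
  by rewrite size_iota ltnn.
have ltf : find p r < (size s).+1 by rewrite -[X in _ < X](size_iota 0) -has_find.
split=> [|k ltk]; first by have := nth_find 0 hasp; rewrite nth_iota.
have := before_find 0 ltk; rewrite nth_iota ?(ltn_trans ltk) //.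
by move/negbFE.
Qed.

Section HypergraphNim.

Variables (V : finType) (H : {set {set V}}).

Implicit Types (x : {ffun V -> nat}) (S T : {set V}).

Definition move : rel {ffun V -> nat} := fun x x' =>
  [forall i, x' i <= x i] && ([set i | x' i < x i] \in H).

Definition stones x : nat := \sum_i x i.

Definition options x : seq {ffun V -> nat} :=
  [seq x' <- [seq [ffun i => f i : nat]
               | f : {ffun V -> 'I_(\max_i x i).+1}] | move x x'].

(* The first argument bounds the recursion depth. When set0 \notin H every
   move removes a stone, so [stones x] is enough; see [grundyE]. *)
Fixpoint grundy_rec (k : nat) x : nat :=
  if k is k'.+1 then mex [seq grundy_rec k' x' | x' <- options x] else 0.

Definition grundy x : nat := grundy_rec (stones x) x.

Fixpoint plays (k : nat) x : seq (seq {ffun V -> nat}) :=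
  if k is k'.+1 then
    flatten [seq [seq x' :: p | p <- plays k' x'] | x' <- options x]
  else [:: [::]].

(* The bound [stones x] on the length of a play is harmless when
   set0 \notin H; see [tetrisP]. *)
Definition tetris x : nat :=
  \max_(k < (stones x).+1 | plays k x != [::]) k.

(* The starting value of the iterated minimum only matters for empty V. *)
Definition min_pile x : nat := \big[minn/(\max_i x i)]_i x i.

Definition yval x : nat := (tetris [ffun i => x i - min_pile x]).+1.

(* Only used for min_pile x > 'C(yval x, 2), where no subtraction truncates. *)
Definition vval x : nat :=
  'C(yval x, 2) + (min_pile x - 'C(yval x, 2) - 1) %% yval x.

Definition Uval x : nat :=
  if min_pile x <= 'C(yval x, 2) then tetris x else vval x.

Definition JM : Prop := forall x, grundy x = Uval x.

Definition symmetric_hypergraph : Prop :=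
  forall A B : {set V}, A \in H -> #|B| = #|A| -> B \in H.

End HypergraphNim.

Section Transversals.

Variable V : finType.

Implicit Types (H : {set {set V}}) (S T : {set V}).

Definition transversal H T : Prop :=
  forall A, A \in H -> T :&: A != set0.

Definition transversal_free H : Prop :=
  forall A, A \in H -> ~ transversal H A.

Definition induced H S : {set {set V}} := [set A in H | A \subset S].

Definition minimal_transversal_free H : Prop :=
  transversal_free H /\
  forall S, S \proper [set: V] -> induced H S != set0 ->
    ~ transversal_free (induced H S).

End Transversals.

Section Specifications.

Variables (V : finType) (H : {set {set V}}).

Implicit Types x : {ffun V -> nat}.

Lemma optionsP x x' : (x' \in options H x) = move H x x'.
Proof.
rewrite mem_filter andb_idr // => /andP[/forallP le_x _].
have lt_m i : x' i < (\max_i x i).+1.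
  by rewrite ltnS (leq_trans (le_x i)) // leq_bigmax.
apply/imageP; exists [ffun i => Ordinal (lt_m i)] => //.
by apply/ffunP => i; rewrite !ffunE.
Qed.

Lemma min_pileP x (i0 : V) :
  (exists i, x i = min_pile x) /\ forall i, min_pile x <= x i.
Proof.
have le_min i : min_pile x <= x i.
  rewrite /min_pile; move: (\max_i x i) (mem_index_enum i) => m.
  elim: (index_enum V) => [|j r IH] //; rewrite inE big_cons geq_min.
  by case/predU1P=> [->|/IH ->]; rewrite ?leqnn ?orbT.
split=> //; pose i := [arg min_(i < i0) x i]; exists i.
apply/eqP; rewrite eqn_leq le_min andbT.
have le_i j : x i <= x j by rewrite /i; case: arg_minnP => // k _; apply.
rewrite /min_pile; elim/big_ind: _ => [|a b|j _] //.
- by apply: leq_bigmax.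
- by rewrite leq_min => -> ->.
Qed.

Hypothesis H0 : set0 \notin H.

Lemma move_stones x x' : move H x x' -> stones x' < stones x.
Proof.
case/andP=> /forallP le_x inH.
have /set0Pn[i] : [set i | x' i < x i] != set0.
  by apply: contraNneq H0 => <-.
rewrite inE => lt_i; rewrite /stones (bigD1 i) //= [X in _ < X](bigD1 i) //=.
by rewrite -addSn leq_add // leq_sum.
Qed.

Lemma grundy_rec_stable k l x :
  stones x <= k -> stones x <= l -> grundy_rec H k x = grundy_rec H l x.
Proof.
have no_option y : stones y = 0 -> options H y = [::].
  move=> y0; case O: (options H y) => [|x' r] //.
  have : x' \in options H y by rewrite O mem_head.
  by rewrite optionsP => /move_stones; rewrite y0.
elim: k l x => [|k IH] [|l] x //=.
- by rewrite leqn0 => /eqP /no_option -> _.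
- by move=> _; rewrite leqn0 => /eqP /no_option ->.
move=> lek lel; congr mex; apply/eq_in_map => x'.
rewrite optionsP => /move_stones lt_x.
by apply: IH; rewrite -ltnS (leq_trans lt_x).
Qed.

Lemma grundyE x : grundy H x = mex [seq grundy H x' | x' <- options H x].
Proof.
rewrite /grundy (@grundy_rec_stable _ (stones x).+1) //=.
congr mex; apply/eq_in_map => x'; rewrite optionsP => /move_stones lt_x.
by apply: grundy_rec_stable => //; apply: ltnW.
Qed.

Lemma grundyP x :
  (forall x', move H x x' -> grundy H x' <> grundy H x) /\
  (forall k, k < grundy H x -> exists2 x', move H x x' & grundy H x' = k).
Proof.
rewrite grundyE; have [nin lt] := mexP [seq grundy H x' | x' <- options H x].
split=> [x' mv eqg|k /lt /mapP[x' mv ->]]; last by exists x'; rewrite -?optionsP.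
by case/negP: nin; rewrite -eqg map_f // optionsP.
Qed.

Lemma playsP k x p :
  (p \in plays H k x) = (size p == k) && path (move H) x p.
Proof.
elim: k x p => [|k IH] x p; first by rewrite inE; case: p.
apply/flatten_mapP/idP => [[x']|].
  rewrite optionsP => mv /mapP[q]; rewrite IH => /andP[/eqP <- pq] -> /=.
  by rewrite eqxx mv pq.
case: p => [|x' p] //= /and3P[sz mv pp]; exists x'; first by rewrite optionsP.
by rewrite map_f // IH pp andbT.
Qed.

Lemma path_stones x p : path (move H) x p -> size p <= stones x.
Proof.
elim: p x => [|x' p IH] x //= /andP[/move_stones lt_x /IH le_p].
exact: leq_ltn_trans le_p lt_x.
Qed.

Lemma tetrisP x :
  (exists2 p, path (move H) x p & size p = tetris H x) /\
  (forall p, path (move H) x p -> size p <= tetris H x).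
Proof.
split=> [|p pp].
  have [k] : {k : 'I_(stones x).+1 | plays H k x != [::] & tetris H x = k}.
    by apply: eq_bigmax_cond; apply/card_gt0P; exists ord0.
  case E: (plays H k x) => [|p r] // _ ->.
  have : p \in plays H k x by rewrite E mem_head.
  by rewrite playsP => /andP[/eqP sz pp]; exists p.
have lt_p : size p < (stones x).+1 by rewrite ltnS path_stones.
rewrite /tetris (bigmax_sup (Ordinal lt_p)) //=.
have : p \in plays H (size p) x by rewrite playsP eqxx.
by case: (plays H _ x).
Qed.

End Specifications.

(* Main.v *)
(** Let k be the least size of an edge. By symmetry t consecutive moves exist
    from x iff k t <= sum_i min(x_i, t), and minimal transversal-freeness says
    that sizes of edges have gaps at most k and largest size n - k.

    Necessity: the all-ones position and the indicators of proper subsets S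
    have known value under JM, which forces the transversality conditions; for
    n = 2 the game is two-pile NIM and (1,3) is a counterexample.

    Sufficiency: write x = w + m e with min w = 0 and call x long if
    m <= 'C(y,2). No move preserves U because a move of a transversal-free
    hypergraph leaves an edge untouched: the Tetris value stays at least m, and
    lowering the minimum by a makes the new y larger than a. All smaller values
    are reached since increasing one pile by one changes the Tetris value by
    at most 1, so for a fixed edge A the values reached fill the interval
    between "A emptied" and "A decreased by 1"; along a chain of edges
    consisting of the highest piles, consecutive intervals leave no hole by the
    gap condition, and edges of size n - k lower the minimum as needed. *)

Require Import Defs.
From mathcomp Require Import all_boot zify.

Set Implicit Arguments.
Unset Strict Implicit.
Unset Printing Implicit Defensive.

(** * A counting criterion for [t] moves, and edges made of the highest piles *)

Section Piles.

Variable V : finType.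

Implicit Types (x y u : {ffun V -> nat}) (A B C : {set V}).

Definition unit_dec x A : {ffun V -> nat} := [ffun i => x i - (i \in A)].

Definition clear x A : {ffun V -> nat} := [ffun i => if i \in A then 0 else x i].

(** In [t] moves pile [i] is used at most [minn (x i) t] times, and each move uses at least [k]
    piles when [k] is the least edge size. *)
Definition feasible k x t := k * t <= \sum_i minn (x i) t.

Lemma sum_nat_mem A : \sum_i (i \in A : nat) = #|A|.
Proof. by rewrite -sum1_card [in RHS]big_mkcond; apply: eq_bigr => i _; case: (i \in A). Qed.

Lemma feasible_mono k x y t :
  (forall i, x i <= y i) -> feasible k x t -> feasible k y t.
Proof.
by move=> le_xy /leq_trans; apply; apply: leq_sum => i _; have := le_xy i; lia.
Qed.

Lemma feasible_many k x t B :
  k <= #|B| -> {in B, forall i, t <= x i} -> feasible k x t.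
Proof.
move=> kB tx; apply: (@leq_trans (#|B| * t)); first by rewrite leq_mul2r kB orbT.
rewrite -sum_nat_const big_mkcond /=; apply: leq_sum => i _.
by case: ifP => // /tx; lia.
Qed.

Lemma feasible_support k x t :
  0 < t -> feasible k x t -> k <= #|[set i | 0 < x i]|.
Proof.
move=> t0 fx; rewrite -(leq_pmul2r t0) (leq_trans fx) //.
rewrite -sum_nat_const [leqRHS]big_mkcond /=; apply: leq_sum => i _.
by rewrite inE; case: ifP; lia.
Qed.

Lemma feasible_le_pile k x t B j :
  #|B| <= k -> j \in B -> (forall i, i \notin B -> x i = 0) ->
  feasible k x t -> t <= x j.
Proof.
move=> Bk jB x0 fx; rewrite leqNgt; apply/negP => lt_jt.
suff : \sum_i minn (x i) t < #|B| * t.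
  by move=> /(leq_ltn_trans fx); rewrite ltn_mul2r => /andP[_]; rewrite ltnNge Bk.
have -> : \sum_i minn (x i) t = \sum_(i in B) minn (x i) t.
  rewrite [RHS]big_mkcond; apply: eq_bigr => i _; case: ifPn => // /x0 ->.
  exact: min0n.
rewrite -sum_nat_const (bigD1 j) //= [ltnRHS](bigD1 j) //= -addSn leq_add //.
  by lia.
by apply: leq_sum => i _; lia.
Qed.

Lemma exists_subset_card (S : {set V}) h :
  h <= #|S| -> exists2 B : {set V}, B \subset S & #|B| = h.
Proof.
move=> le_h; exists [set i in take h (enum S)].
  by apply/subsetP => i; rewrite inE => /mem_take; rewrite mem_enum.
rewrite cardsE (card_uniqP _) ?take_uniq ?enum_uniq // size_take_min -cardE.
by lia.
Qed.

(* Decreasing a pile higher than [t] does not change its truncation at [t],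
   so A should contain all these piles, or as many of them as possible. *)
Lemma feasible_unit_dec k x t A :
  #|A| = k -> {in A, forall i, 0 < x i} ->
  [set i | t < x i] \subset A \/ k <= #|[set i | t < x i]| ->
  feasible k x t.+1 -> feasible k (unit_dec x A) t.
Proof.
move=> kA posA [sub|many] fx; last first.
  apply: (feasible_many many) => i; rewrite inE ffunE.
  by case: (i \in A) => /=; lia.
rewrite /feasible -(leq_add2r k) -mulnSr (leq_trans fx) // -{1}kA -sum_nat_mem -big_split.
apply: leq_sum => i _; rewrite ffunE /=; case: (boolP (i \in A)) => iA.
  by have := posA i iA; lia.
by have := contra (subsetP sub i) iA; rewrite inE; lia.
Qed.

(** If a pile outside [A] exceeds [t], so do all piles of [B], and they stay at least [t]. Otherwise
    no pile outside [A] is truncated, and only the at most [k] piles of [A' :\: A] lose a stone,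
    which makes up for the step from [k * t.+1] to [k * t]. *)
Lemma feasible_clear_unit_dec k x t A A' B :
  A \subset A' -> #|A'| <= #|A| + k -> k <= #|B| ->
  (forall i j, i \in B -> j \notin A -> x j <= x i) ->
  feasible k (clear x A) t.+1 -> feasible k (unit_dec x A') t.
Proof.
move=> sub leA kB topB fx.
case: (boolP [exists j, (j \notin A) && (t < x j)]) => [/existsP[j /andP[jA tj]]|].
  apply: (feasible_many kB) => i iB; rewrite ffunE.
  by have := topB i j iB jA; case: (i \in A') => /=; lia.
rewrite negb_exists => /forallP small.
have := fx; rewrite /feasible mulnSr => {}fx.
have: \sum_i minn (clear x A i) t.+1 <=
      \sum_i (minn (unit_dec x A' i) t + (i \in A' :\: A)).
  apply: leq_sum => i _; have := small i; rewrite !ffunE !inE.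
  by case: (i \in A); case: (i \in A') => /=; lia.
rewrite big_split sum_nat_mem /= => le_sum.
have : #|A' :\: A| <= k by rewrite cardsD (setIidPr sub); lia.
lia.
Qed.

(** The vertex [c] is exempt from the comparison, so that a prescribed pile, possibly the smallest
    one, takes part in the move. *)
Definition top_with x c A :=
  c \in A /\ forall i j, i \in A -> i != c -> j \notin A -> x j <= x i.

Lemma top_chain x c : exists G : nat -> {set V},
  [/\ forall h h', h <= h' -> G h \subset G h',
      forall h, h <= #|V| -> #|G h| = h
    & forall h, 0 < h -> top_with x c (G h)].
Proof.
pose r := sort (fun i j => x j <= x i) (rem c (enum V)).
have us : uniq (c :: r).
  rewrite /= mem_sort sort_uniq rem_uniq ?enum_uniq // andbT.
  by rewrite (mem_rem_uniq c (enum_uniq V)) !inE eqxx.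
have ss : size (c :: r) = #|V|.
  rewrite /= size_sort size_rem ?mem_enum // -cardE prednK //.
  by apply/card_gt0P; exists c.
have ms i : i \in c :: r.
  rewrite inE mem_sort (mem_rem_uniq c (enum_uniq V)) !inE mem_enum.
  by case: eqP.
have sr : pairwise (fun i j => x j <= x i) r.
  rewrite -sorted_pairwise; first by apply: sort_sorted => i j; apply: leq_total.
  by move=> i j l /= ij jl; apply: leq_trans jl ij.
exists (fun h => [set i in take h (c :: r)]); split.
- move=> h h' le_h; apply/subsetP => i; rewrite !inE.
  by rewrite -(take_takel _ le_h); apply: mem_take.
- move=> h le_h; rewrite cardsE (card_uniqP _) ?take_uniq //.
  by rewrite size_take_min ss; lia.
move=> [|h] // _; split; first by rewrite inE mem_head.
move=> i j; rewrite ![_ \in [set _ in _]]inE /= => + /negPf ic.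
rewrite !inE ic /= => iG; rewrite negb_or => /andP[jc jG].
have jD : j \in drop h r.
  by have := ms j; rewrite inE (negPf jc) -{1}(cat_take_drop h r) mem_cat (negPf jG).
move: sr; rewrite -{1}(cat_take_drop h r) pairwise_cat => /and3P[/allrelP al _ _].
exact: al.
Qed.

(** An empty pile in [A] would differ from [c] and force all piles outside [A] to be empty. *)
Lemma top_with_gt0 x c A : top_with x c A -> 0 < x c ->
  #|A| <= #|[set i | 0 < x i]| -> {in A, forall i, 0 < x i}.
Proof.
move=> [_ topA] xc le_s i iA; rewrite lt0n; apply/negP => /eqP xi.
have ic : i != c by apply: contraTneq xc => <-; rewrite xi.
suff /proper_card : [set i | 0 < x i] \proper A by rewrite ltnNge le_s.
apply/properP; split; last by exists i; rewrite // inE xi.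
apply/subsetP => j; rewrite inE; apply: contraTT => /(topA _ _ iA ic).
by rewrite xi; lia.
Qed.

Lemma feasible_top_unit_dec k x t c A : top_with x c A -> 0 < x c -> #|A| = k ->
  feasible k x t.+1 -> feasible k (unit_dec x A) t.
Proof.
move=> topA xc kA fx; have [cA geA] := topA.
apply: feasible_unit_dec => //.
  by apply: top_with_gt0 topA xc _; rewrite kA; apply: feasible_support fx.
have [?|lt_N] := leqP k #|[set i | t < x i]|; [by right | left].
apply/subsetP => j jN; apply: contraTT lt_N => jA; rewrite -leqNgt -kA.
(* If [j], above [t], is missing from [A], the [k - 1] members of [A] other than [c] are at least as
   high; together with [j] they are [k] piles above [t]. *)
have sub : A :\ c \subset [set i | t < x i] :\ j.
  apply/subsetP => i; rewrite !inE => /andP[ic iA].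
  rewrite (contraTneq _ iA) => [|->] //=.
  by apply: leq_trans (geA _ _ iA ic jA); rewrite inE in jN.
have := subset_leq_card sub; rewrite (cardsD1 c A) cA (cardsD1 j [set i | _]) jN.
by lia.
Qed.

Lemma feasible_clear_top k x t c A A' :
  top_with x c A -> top_with x c A' -> A \proper A' ->
  k <= #|A| -> #|A'| <= #|A| + k ->
  feasible k (clear x A) t.+1 -> feasible k (unit_dec x A') t.
Proof.
move=> [cA topA] [_ topA'] /properP[sub [e0 e0A' e0A]] kA leA'.
have De0 : e0 \in A' :\: A by rewrite inE e0A.
pose e := [arg max_(i > e0 in A' :\: A) x i].
have [eA eA' maxe] : [/\ e \notin A, e \in A' & forall j, j \in A' :\: A -> x j <= x e].
  by rewrite /e; case: arg_maxnP => // i; rewrite inE => /andP[].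
have ec : e != c by apply: contraNneq eA => ->.
(* As [c] may be low, it is replaced by [e], the highest pile of [A' :\: A]; the resulting set
   dominates all piles outside [A]. *)
apply: (@feasible_clear_unit_dec _ _ _ _ _ (e |: (A :\ c))) => //.
  rewrite cardsU1 !inE (negPf eA) andbF /=.
  by move: kA; rewrite (cardsD1 c A) cA; lia.
move=> i j; rewrite !inE => /predU1P[->|/andP[ic iA]] jA; last exact: topA.
have [jA'|jA'] := boolP (j \in A'); last exact: topA'.
by apply: maxe; rewrite inE jA jA'.
Qed.

End Piles.

(** * The Tetris function of a symmetric hypergraph *)

Section SymmetricTetris.

Variables (V : finType) (H : {set {set V}}) (k : nat).

Hypothesis H0 : set0 \notin H.
Hypothesis Hsym : symmetric_hypergraph H.
Hypothesis Hmin : forall A, A \in H -> k <= #|A|.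
Hypothesis Hk : exists2 A, A \in H & #|A| = k.

Implicit Types (x y u : {ffun V -> nat}) (A B C : {set V}).

Local Notation T := (tetris H).

Lemma mem_card_min A : #|A| = k -> A \in H.
Proof. by case: Hk => B BH <- AB; apply: Hsym BH AB. Qed.

Lemma min_card_gt0 : 0 < k.
Proof. by case: Hk => A AH <-; rewrite card_gt0; apply: contraNneq H0 => <-. Qed.

Lemma moveI x x' A : A \in H -> {in A, forall i, x' i < x i} ->
  (forall i, i \notin A -> x' i = x i) -> move H x x'.
Proof.
move=> AH lt eq; rewrite /move; have -> : [set i | x' i < x i] = A.
  apply/setP => i; rewrite inE; case: (boolP (i \in A)) => [/lt //|/eq ->].
  exact: ltnn.
rewrite AH andbT; apply/forallP => i.
by case: (boolP (i \in A)) => [/lt /ltnW //|/eq ->].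
Qed.

Lemma unit_dec_move x A :
  A \in H -> {in A, forall i, 0 < x i} -> move H x (unit_dec x A).
Proof.
move=> AH pos; apply: (moveI AH) => i iA; rewrite ffunE.
  by have := pos i iA; rewrite iA; lia.
by rewrite (negPf iA) subn0.
Qed.

Lemma feasible_top x t c : 0 < x c -> feasible k x t.+1 ->
  exists A, [/\ #|A| = k, c \in A, {in A, forall i, 0 < x i}
              & feasible k (unit_dec x A) t].
Proof.
move=> xc fx; have [G [_ Gcard Gtop]] := top_chain x c.
have le_s := feasible_support (ltn0Sn t) fx.
have kG : #|G k| = k by apply: Gcard; apply: leq_trans le_s (max_card _).
have topG := Gtop _ min_card_gt0; exists (G k); split=> //; first by case: topG.
  by apply: top_with_gt0 topG xc _; rewrite kG.
exact: feasible_top_unit_dec topG xc kG fx.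
Qed.

Lemma move_feasible x x' t : move H x x' -> feasible k x' t -> feasible k x t.+1.
Proof.
case/andP=> /forallP le_x AH fx; set A := [set i | _] in AH.
rewrite /feasible mulnSr (leq_trans (leq_add fx (Hmin AH))) //.
rewrite -sum_nat_mem -big_split /=; apply: leq_sum => i _.
by have := le_x i; rewrite inE; lia.
Qed.

Lemma tetris_geE x t : (t <= T x) = feasible k x t.
Proof.
have [[p pp sz] maxp] := tetrisP H0 x.
have le_feasible s : s <= T x -> feasible k x s.
  rewrite -sz; elim: s x p pp {sz maxp} => [|s IH] x' p; first by rewrite /feasible muln0.
  by case: p => [|y p] //= /andP[mv /IH{}IH] /IH; apply: move_feasible mv.
apply/idP/idP => [|fx]; first exact: le_feasible.
(* A greedy play: each move takes one stone from [k] top piles, which keeps the remaining moves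
   feasible. *)
suff [q pq <-] : exists2 q, path (move H) x q & size q = t by apply: maxp.
elim: t x {p pp sz maxp le_feasible} fx => [|t IH] x fx; first by exists [::].
have /card_gt0P[c] : 0 < #|[set i | 0 < x i]|.
  by apply: leq_trans min_card_gt0 (feasible_support _ fx).
rewrite inE => xc; have [A [kA _ pos /IH[q pq sq]]] := feasible_top xc fx.
exists (unit_dec x A :: q); rewrite /= ?sq // pq andbT.
exact: unit_dec_move (mem_card_min kA) pos.
Qed.

Lemma tetris_feasible x : feasible k x (T x).
Proof. by rewrite -tetris_geE. Qed.

Lemma tetris_mono x y : (forall i, x i <= y i) -> T x <= T y.
Proof. by move=> le_xy; rewrite tetris_geE; apply: feasible_mono (tetris_feasible x). Qed.

(** A longest play may start with a unit move on an edge through [i], and what this move leaves lies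
    below [unit_dec x [set i]]. *)
Lemma tetris_unit_dec1 x i : (T x).-1 <= T (unit_dec x [set i]).
Proof.
case E: (T x) => [|t] //=; rewrite tetris_geE.
have fx : feasible k x t.+1 by rewrite -E tetris_feasible.
have [xi|xi] := posnP (x i).
  apply: (@feasible_mono _ _ x); last by rewrite -tetris_geE E.
  by move=> j; rewrite ffunE inE; case: eqP => [->|]; lia.
have [A [_ iA _]] := feasible_top xi fx; apply: feasible_mono => j; rewrite !ffunE inE.
by case: (j =P i) => [->|]; rewrite ?iA //; lia.
Qed.

(** Stones are removed from [y] one at a time, staying above [x]; each removal lowers the Tetris
    value by at most one, so [z] is not skipped. *)
Lemma tetris_interpolate x y z : (forall i, x i <= y i) -> T x <= z <= T y ->
  exists2 u : {ffun V -> nat}, forall i, x i <= u i <= y i & T u = z.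
Proof.
move=> le_xy; have [N] := ubnP (stones y).
elim: N y le_xy => // N IH y le_xy; rewrite ltnS => leN.
case/andP=> le_z; rewrite leq_eqVlt => /predU1P[->|lt_z].
  by exists y => // i; rewrite le_xy leqnn.
have /existsP[i lt_i] : [exists i, x i < y i].
  rewrite -[[exists i, _]]negbK negb_exists; apply/negP => /forallP ge_x.
  have /tetris_mono : forall i, y i <= x i by move=> i; rewrite leqNgt ge_x.
  by lia.
have [] // := IH (unit_dec y [set i]).
- by move=> j; rewrite ffunE inE; case: eqP => [->|_]; have := le_xy j; lia.
- apply: leq_trans leN; rewrite /stones (bigD1 i) //= [ltnRHS](bigD1 i) //=.
  rewrite -addSn leq_add //; first by rewrite ffunE inE eqxx; lia.
  by apply: leq_sum => j _; rewrite ffunE leq_subr.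
- by rewrite le_z; have := tetris_unit_dec1 y i; lia.
move=> u xu Tu; exists u => // j; have := xu j; rewrite !ffunE; lia.
Qed.

Lemma tetris_many x t B : k <= #|B| -> {in B, forall i, t <= x i} -> t <= T x.
Proof. by move=> kB tx; rewrite tetris_geE; apply: feasible_many kB tx. Qed.

(** With at most [k] nonempty piles and no edge smaller than [k], every move takes from [j]. *)
Lemma tetris_le_pile x B j : #|B| <= k -> j \in B ->
  (forall i, i \notin B -> x i = 0) -> T x <= x j.
Proof. by move=> Bk jB x0; apply: (feasible_le_pile Bk jB x0); apply: tetris_feasible. Qed.

Lemma move_tetris x x' : move H x x' -> T x' < T x.
Proof.
move=> mv; rewrite tetris_geE; apply: move_feasible mv _; exact: tetris_feasible.
Qed.

End SymmetricTetris.

(** * Splitting a position into its minimum and the rest *)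

Section Shift.

Variables (V : finType) (H : {set {set V}}).

Implicit Types (x w : {ffun V -> nat}).

Definition shift w m : {ffun V -> nat} := [ffun i => w i + m].

Definition lower x : {ffun V -> nat} := [ffun i => x i - min_pile x].

Lemma min_pile_eq x o m : x o = m -> (forall i, m <= x i) -> min_pile x = m.
Proof.
move=> xo le_m; have [[i xi] min_le] := min_pileP x o.
by apply/eqP; rewrite eqn_leq -{1}xo min_le -xi le_m.
Qed.

Lemma min_pile_le x i : min_pile x <= x i.
Proof. by have [_] := min_pileP x i. Qed.

Lemma lowerK x : shift (lower x) (min_pile x) = x.
Proof. by apply/ffunP => i; rewrite !ffunE subnK // min_pile_le. Qed.

Lemma min_pile_shift w o m : w o = 0 -> min_pile (shift w m) = m.
Proof.
by move=> wo; apply: (@min_pile_eq _ o) => [|i]; rewrite ffunE ?wo // leq_addl.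
Qed.

Lemma yval_shift w o m : w o = 0 -> yval H (shift w m) = (tetris H w).+1.
Proof.
move=> wo; rewrite /yval (min_pile_shift _ wo); congr (tetris H _).+1.
by apply/ffunP => i; rewrite !ffunE addnK.
Qed.

Lemma yval_lower x : yval H x = (tetris H (lower x)).+1.
Proof. by []. Qed.

Lemma move_shift w w' m : move H w w' -> move H (shift w m) (shift w' m).
Proof.
case/andP => /forallP le_w mv; apply/andP; split.
  by apply/forallP => i; rewrite !ffunE leq_add2r.
by congr (_ \in H): mv; apply/setP => i; rewrite !inE !ffunE ltn_add2r.
Qed.

End Shift.

(** * Triangular numbers *)

Lemma binS2 p : 'C(p.+1, 2) = 'C(p, 2) + p.
Proof. by rewrite binS bin1. Qed.

(** With [triangular_interval_inj]: these intervals partition the naturals, so a value of [vval]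
    determines both [yval] and the remainder. *)
Lemma triangular_interval z : exists2 p, 0 < p & 'C(p, 2) <= z < 'C(p, 2) + p.
Proof.
elim: z => [|z [p p0 /andP[le_z lt_z]]]; first by exists 1.
have [lt_Sz|ge_Sz] := ltnP z.+1 ('C(p, 2) + p).
  by exists p => //; rewrite lt_Sz andbT ltnW.
by exists p.+1; rewrite // binS2; lia.
Qed.

Lemma triangular_interval_inj p q r s : r < p -> s < q ->
  'C(p, 2) + r = 'C(q, 2) + s -> p = q /\ r = s.
Proof.
move=> rp sq E; case: (ltngtP p q) => [lt_pq|lt_qp|eq_pq].
- by have := leq_bin2l 2 lt_pq; rewrite binS2; lia.
- by have := leq_bin2l 2 lt_qp; rewrite binS2; lia.
by split=> //; move: E; rewrite eq_pq; lia.
Qed.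

(** * Sufficiency, from conditions on edge sizes *)

Section MinimalTransversalFree.

Variables (V : finType) (H : {set {set V}}) (k : nat).

Hypothesis H0 : set0 \notin H.
Hypothesis Hsym : symmetric_hypergraph H.
Hypothesis Hmin : forall A, A \in H -> k <= #|A|.
Hypothesis Hk : exists2 A, A \in H & #|A| = k.
Hypothesis Htf : forall A, A \in H -> #|A| + k <= #|V|.
Hypothesis Hgap : forall h, k <= h < #|V| ->
  exists2 A, A \in H & #|A| <= h < #|A| + k.
Hypothesis Hcard : 2 < #|V|.

Implicit Types (x y u w : {ffun V -> nat}) (A B C : {set V}).

Local Notation T := (tetris H).
Local Notation U := (Uval H).

Lemma min_card_bounds : 0 < k /\ k.*2 <= #|V|.
Proof.
split; first exact: min_card_gt0 H0 Hk.
by have [A /Htf + kA] := Hk; rewrite kA addnn.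
Qed.

(** The gap condition just below [#|V|] yields an edge of size at least [#|V| - k], and [Htf] makes
    the size exact. *)
Lemma mem_compl_min C : #|C| = k -> ~: C \in H.
Proof.
move=> kC; have [k0 k2] := min_card_bounds.
have [|A AH ltA] := Hgap (h := #|V|.-1); first by lia.
by apply: (Hsym AH); have := Htf AH; have := cardsC C; lia.
Qed.

(** At edge size [l], emptying the top piles already brings the value down to [z]; let [h] be the
    least such size in the chain. If [h = k], a unit move on [G h] costs only one. Otherwise some
    smaller edge of the chain, of size at least [h - k], leaves more than [z] when emptied, and
    [feasible_clear_top] applies. *)
Lemma chain_edge x c z l : 0 < x c -> z < T x ->
  (exists2 B, B \in H & #|B| = l) -> l <= #|[set i | 0 < x i]| ->
  (forall A, #|A| = l -> top_with x c A -> {in A, forall i, 0 < x i} ->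
     T (clear x A) <= z) ->
  exists A, [/\ A \in H, c \in A, {in A, forall i, 0 < x i}
              & T (clear x A) <= z <= T (unit_dec x A)].
Proof.
move=> xc lt_z [B BH Bl] le_s last_le.
have [G [Gsub Gcard Gtop]] := top_chain x c.
have k0 := min_card_gt0 H0 Hk.
have le_sV : #|[set i | 0 < x i]| <= #|V| := max_card _.
have GH A h : A \in H -> #|A| = h -> h <= #|V| -> G h \in H.
  by move=> AH Ah hV; apply: Hsym AH _; rewrite Gcard.
pose P h := [&& h <= #|V|, G h \in H & T (clear x (G h)) <= z].
have lV : l <= #|V| by lia.
have GHl := GH B l BH Bl lV.
have l0 : 0 < l by rewrite -Bl (leq_trans k0) // Hmin.
have exP : exists h, P h.
  exists l; rewrite /P lV GHl last_le ?Gcard //; first exact: Gtop.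
  by apply: top_with_gt0 (Gtop _ l0) xc _; rewrite Gcard.
have [h /and3P[hV hH hz] minh] := ex_minnP exP.
have le_kh : k <= h by rewrite -(Gcard h hV) Hmin.
have le_hl : h <= l.
  apply: minh; rewrite /P lV GHl last_le ?Gcard //; first exact: Gtop.
  by apply: top_with_gt0 (Gtop _ l0) xc _; rewrite Gcard.
have topG : top_with x c (G h) by apply: Gtop; lia.
exists (G h); split=> //; first by case: topG.
  by apply: top_with_gt0 topG xc _; rewrite Gcard //; lia.
rewrite hz (tetris_geE H0 Hsym Hmin Hk); move: le_kh; rewrite leq_eqVlt.
case/predU1P=> [kh|lt_kh].
  apply: (feasible_top_unit_dec topG xc); first by rewrite -kh Gcard // kh.
  by rewrite -(tetris_geE H0 Hsym Hmin Hk).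
have [|A AH /andP[le_A lt_A]] := Hgap (h := h.-1); first by lia.
have AV : #|A| <= #|V| := max_card _.
have kA := Hmin AH.
have cGA := Gcard _ AV.
apply: (@feasible_clear_top _ _ _ _ c (G #|A|)) => //.
- by apply: Gtop; lia.
- rewrite properEcard Gsub ?Gcard //; lia.
- by rewrite cGA.
- by rewrite cGA Gcard //; lia.
rewrite -(tetris_geE H0 Hsym Hmin Hk) ltnNge; apply/negP => le_z.
have /minh : P #|A| by rewrite /P AV le_z (GH A).
by lia.
Qed.

(** The chain ends at an edge size above [#|S| - k], where [S] is the set of nonempty piles:
    emptying such an edge leaves fewer than [k] nonempty piles. The empty pile [o] makes the gap
    condition applicable at [#|S|]. *)
Lemma reach_tetris x o z : x o = 0 -> z < T x ->
  exists2 x', move H x x' & T x' = z.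
Proof.
move=> xo lt_z; have k0 := min_card_gt0 H0 Hk.
set S := [set i | 0 < x i].
have kS : k <= #|S|.
  by apply: (@feasible_support _ _ _ z.+1) => //; rewrite -(tetris_geE H0 Hsym Hmin Hk).
have SV : #|S| < #|V|.
  rewrite -cardsT; apply: proper_card; apply/properP; split; first exact: subsetT.
  by exists o; rewrite ?inE // xo.
have [|B BH /andP[le_B lt_B]] := Hgap (h := #|S|); first by rewrite kS.
have /card_gt0P[c] : 0 < #|S| by lia.
rewrite inE => xc.
have [|//|A] := @chain_edge x c z #|B| xc lt_z _ le_B; first by exists B.
  move=> A cA _ posA; suff /eqP-> : T (clear x A) == 0 by [].
  rewrite eqn0Ngt (tetris_geE H0 Hsym Hmin Hk); apply/negP => /(feasible_support (ltn0Sn 0)).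
  suff /subset_leq_card : [set i | 0 < clear x A i] \subset S :\: A.
    rewrite cardsD (setIidPr _); last by apply/subsetP => i /posA; rewrite inE.
    by lia.
  by apply/subsetP => i; rewrite !inE ffunE; case: (i \in A).
case=> AH _ posA /(tetris_interpolate H0 Hsym Hmin Hk)[i|u le_u Tu].
  by rewrite !ffunE; case: (i \in A); rewrite //= subn0.
exists u => //; apply: (moveI AH) => i iA; have := le_u i; rewrite !ffunE.
  by rewrite iA; have := posA i iA; lia.
by rewrite (negPf iA); lia.
Qed.

Lemma exists_card_set c d : c != d -> exists C, [/\ #|C| = k, c \in C & d \notin C].
Proof.
move=> cd; have [k0 k2] := min_card_bounds.
(* Only [d] gets height 0, so a top set of [k < #|V|] vertices omits it. *)
have [G [_ Gcard Gtop]] := top_chain [ffun i => i != d : nat] c.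
have kG : #|G k| = k by apply: Gcard; lia.
have [cG topG] := Gtop _ k0; exists (G k); split=> //; apply/negP => dG.
have /set0Pn[j] : ~: G k != set0 by rewrite -card_gt0; have := cardsC (G k); lia.
rewrite inE => jG; have := topG d j dG; rewrite eq_sym cd !ffunE eqxx => /(_ isT jG).
by case: eqP => // jd; rewrite jd dG in jG.
Qed.

(** The move is on [~: C], with heights measured from the new minimum [m - a], attained at [e]. At
    the low end only the [k] piles of [C] remain, so the value is at most [w j + a]; at the high end
    the touched piles other than [e] lose one stone. *)
Lemma reach_interval w m a q C e j : 0 < a <= m -> #|C| = k -> e \notin C ->
  j \in C -> w j + a <= q ->
  q <= T [ffun i => if i == e then 0 else w i + a - (i \notin C)] ->
  exists w', [/\ w' e = 0, T w' = q & move H (shift w m) (shift w' (m - a))].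
Proof.
move=> /andP[a0 am] kC eC jC le_q; set hi := finfun _ => q_le.
pose lo : {ffun V -> nat} := [ffun i => if i \in C then w i + a else 0].
have lo_hi i : lo i <= hi i.
  rewrite !ffunE; case: (i =P e) => [->|_]; first by rewrite (negPf eC).
  by case: (i \in C); rewrite /= ?subn0.
have lo_q : T lo <= q.
  apply: leq_trans (le_q); have -> : w j + a = lo j by rewrite ffunE jC.
  apply: (tetris_le_pile H0 Hsym Hmin Hk (B := C)) => //; first by rewrite kC.
  by move=> i iC; rewrite ffunE (negPf iC).
have [|u le_u Tu] := tetris_interpolate H0 Hsym Hmin Hk lo_hi (z := q).
  by rewrite lo_q.
exists u; split=> //; first by have := le_u e; rewrite !ffunE eqxx; lia.
apply: (moveI (mem_compl_min kC)) => i; rewrite inE => iC; have := le_u i; rewrite !ffunE.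
  by rewrite (negPf iC) /=; case: eqP; lia.
rewrite negbK in iC; rewrite iC /= subn0.
by case: eqP => [ie|_]; [rewrite -ie iC in eC | lia].
Qed.

Lemma reach_low w m a q c d : c != d -> w c = 0 ->
  (forall i, i != c -> w d <= w i) -> 0 < a <= m -> a <= q < a + w d ->
  exists w', [/\ w' d = 0, T w' = q & move H (shift w m) (shift w' (m - a))].
Proof.
move=> cd wc wd am /andP[aq qd]; have [k0 k2] := min_card_bounds.
have [C [kC cC dC]] := exists_card_set cd.
apply: (reach_interval am kC dC cC); first by rewrite wc.
(* Piles other than [c] and [d] keep at least [a + w d - 1]. There are at least [k] of them: for
   [k >= 2] because [#|V| >= 2k], for [k = 1] because [#|V| > 2]. *)
apply: (tetris_many H0 Hsym Hmin Hk (B := ~: [set c; d])).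
  by have := cardsC [set c; d]; rewrite cards2 cd; lia.
move=> i; rewrite !inE negb_or => /andP[/wd ic /negPf id]; rewrite ffunE id.
by case: (i \in C) => /=; lia.
Qed.

Lemma exists_second_min w c : exists2 d, c != d & forall i, i != c -> w d <= w i.
Proof.
have /card_gt0P[d0 d0c] : 0 < #|[set~ c]| by rewrite cardsC1; lia.
exists [arg min_(i < d0 in [set~ c]) w i]; case: arg_minnP => // d.
  by rewrite !inE eq_sym.
by move=> _ min_d i ic; apply: min_d; rewrite !inE.
Qed.

(** Below [a + w d], the second smallest pile [d] becomes the new minimum. From there on [c] does:
    since [a >= 1], unit decreases leave no pile lower than in [w], relative to the new minimum, so
    the interval extends to [T w]. *)
Lemma reach_lower w m a q c : w c = 0 -> 0 < a <= m -> a <= q <= T w ->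
  exists w' o, [/\ w' o = 0, T w' = q & move H (shift w m) (shift w' (m - a))].
Proof.
move=> wc am /andP[aq qT]; have [d cd wd] := exists_second_min w c.
have [lt_q|ge_q] := ltnP q (a + w d).
  have [|w' w'P] := reach_low (q := q) cd wc wd am; first by rewrite aq.
  by exists w', d.
have [|C [kC dC cC]] := exists_card_set (c := d) (d := c); first by rewrite eq_sym.
have [||w' w'P] := reach_interval (q := q) (w := w) am kC cC dC; last by exists w', c.
  by rewrite addnC.
apply: leq_trans qT _; apply: (tetris_mono H0 Hsym Hmin Hk) => i; rewrite ffunE.
by case: eqP => [->|_]; [rewrite wc | case: (i \in C) => /=; lia].
Qed.

(** The target has [yval] equal to [p] and minimum [m - a] congruent to [z.+1] modulo [p], which
    makes its [vval] equal to [z]. The least such [a] is at most [p - 1], as the lowering lemmas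
    require. If [a = 0], the Tetris value of [lower x] must strictly drop to [p.-1], so
    [p = yval H x] has to be excluded. *)
Lemma reach_short x z p :
  z < min_pile x -> 'C(p, 2) <= z < 'C(p, 2) + p -> p <= yval H x ->
  (p = yval H x -> (min_pile x - z.+1) %% p <> 0) ->
  exists2 x', move H x x' & U x' = z.
Proof.
set m := min_pile x; set w := lower x => lt_zm /andP[Cz zC] py pyN.
have /card_gt0P[o _] : 0 < #|V| by lia.
have [[c xc] _] := min_pileP x o.
have wc : w c = 0 by rewrite ffunE xc subnn.
pose a := (m - z.+1) %% p; have p0 : 0 < p by lia.
have ap : a < p by rewrite ltn_mod.
have az : a <= m - z.+1 by apply: leq_mod.
have vE w' o' : w' o' = 0 -> T w' = p.-1 -> U (shift w' (m - a)) = z.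
  move=> w'0 Tw'; rewrite /Uval /vval (yval_shift _ _ w'0) (min_pile_shift _ w'0).
  rewrite Tw' prednK //; case: leqP => [|_]; first by lia.
  have -> : m - a - 'C(p, 2) - 1 = (m - z.+1) %/ p * p + (z - 'C(p, 2)).
    by have := divn_eq (m - z.+1) p; rewrite -/a; lia.
  by rewrite modnMDl modn_small; lia.
rewrite yval_lower -/w in py pyN.
have [a0|a0] := posnP a.
  have [|w' mv Tw'] := @reach_tetris w c p.-1 wc.
    by rewrite ltnNge; apply/negP => le_p; apply: pyN => //; lia.
  have w'c : w' c = 0.
    by case/andP: mv => /forallP /(_ c) + _; rewrite wc leqn0 => /eqP.
  exists (shift w' (m - a)); last exact: vE w'c Tw'.
  by rewrite a0 subn0 -[x]lowerK; apply: move_shift.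
have [||w' [o' [w'o Tw' mv]]] := @reach_lower w m a p.-1 c wc; [by lia|by lia|].
exists (shift w' (m - a)); last exact: vE w'o Tw'.
by rewrite -[x]lowerK.
Qed.

Lemma Uval_long x : min_pile x <= 'C(yval H x, 2) -> U x = T x.
Proof. by rewrite /Uval => ->. Qed.

Lemma reach_long x z : min_pile x <= 'C(yval H x, 2) -> min_pile x <= z < T x ->
  exists2 x', move H x x' & U x' = z.
Proof.
move=> long_x /andP[le_z lt_z]; have [k0 k2] := min_card_bounds.
have /card_gt0P[o _] : 0 < #|V| by lia.
have [[c xc] min_x] := min_pileP x o.
have U0 x' i : x' i = 0 -> U x' = T x'.
  by move=> x'i; apply: Uval_long; rewrite (min_pile_eq x'i).
have [m0|m0] := posnP (min_pile x).
  rewrite m0 in xc; have [x' mv Tx'] := reach_tetris xc lt_z.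
  exists x' => //; rewrite (U0 _ c) //.
  by case/andP: mv => /forallP /(_ c) + _; rewrite xc leqn0 => /eqP.
have [d cd xd] := exists_second_min x c.
(* Lowering by the whole minimum empties pile [d], so [U] and [T] agree there. *)
have [lt_zd|ge_zd] := ltnP z (x d).
  have [||||w' [w'd Tw' mv]] :=
    @reach_low (lower x) (min_pile x) (min_pile x) z c d cd.
  - by rewrite ffunE xc subnn.
  - by move=> i /xd le_di; rewrite !ffunE leq_sub2r.
  - by rewrite m0 leqnn.
  - by rewrite le_z ffunE subnKC.
  have w'E : shift w' (min_pile x - min_pile x) = w'.
    by apply/ffunP => i; rewrite ffunE subnn addn0.
  by rewrite lowerK w'E in mv; exists w'; rewrite ?(U0 _ d).
have [B [kB _ _]] := exists_card_set cd.
have [||||A] := @chain_edge x c z #|~: B| _ lt_z.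
- by rewrite xc.
- by exists (~: B) => //; apply: mem_compl_min.
- suff -> : [set i | 0 < x i] = setT by rewrite cardsT max_card.
  by apply/setP => i; rewrite !inE (leq_trans m0).
- move=> A cA [_ topA] _.
  have cCA : #|~: A| = k by have := cardsC A; have := cardsC B; lia.
  (* The [k] piles left after emptying [A] include one of height at most [x d <= z], which every
     further move would use. *)
  have [j jA xj] : exists2 j, j \notin A & x j <= x d.
    have [dA|dA] := boolP (d \in A); last by exists d.
    have /card_gt0P[j] : 0 < #|~: A| by rewrite cCA.
    by rewrite inE => jA; exists j; rewrite // topA // eq_sym.
  apply: leq_trans ge_zd; apply: leq_trans xj.
  have -> : x j = clear x A j by rewrite ffunE (negPf jA).
  apply: (tetris_le_pile H0 Hsym Hmin Hk (B := ~: A)); rewrite ?cCA ?inE //.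
  by move=> i; rewrite inE negbK ffunE => ->.
case=> AH cA posA /andP[lo_z z_hi].
(* Up to [mid] the pile [c] is empty, hence [U] is [T]; beyond it only [c] may lose more than one
   stone, so [c] holds the minimum. *)
pose mid : {ffun V -> nat} := [ffun i => if i == c then 0 else x i - (i \in A)].
have moveA u : (forall i, clear x A i <= u i <= unit_dec x A i) -> move H x u.
  move=> le_u; apply: (moveI AH) => i iA; have := le_u i; rewrite !ffunE.
    by rewrite iA; have := posA i iA; lia.
  by rewrite (negPf iA); lia.
have lo_mid i : clear x A i <= mid i.
  rewrite !ffunE; case: (i =P c) => [->|_]; first by rewrite cA.
  by case: (i \in A) => //=; rewrite subn0.
have mid_hi i : mid i <= unit_dec x A i by rewrite !ffunE; case: eqP.
have [z_mid|/ltnW mid_z] := leqP z (T mid).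
  have [|u le_u Tu] := tetris_interpolate H0 Hsym Hmin Hk lo_mid (z := z).
    by rewrite lo_z.
  exists u; last by rewrite (U0 _ c) //; have := le_u c; rewrite !ffunE eqxx; lia.
  by apply: moveA => i; have := le_u i; have := mid_hi i; lia.
have [|u le_u Tu] := tetris_interpolate H0 Hsym Hmin Hk mid_hi (z := z).
  by rewrite mid_z.
exists u; first by apply: moveA => i; have := le_u i; have := lo_mid i; lia.
have uc : u c < min_pile x.
  by have := le_u c; rewrite -xc !ffunE eqxx cA; have := posA c cA; lia.
have ui i : i != c -> (x i).-1 <= u i.
  by move=> /negPf ic; have := le_u i; rewrite !ffunE ic; case: (i \in A) => /=; lia.
have mu : min_pile u = u c.
  apply: (min_pile_eq (o := c)) => // i; have [->//|/ui] := eqVneq i c.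
  by have := min_x i; lia.
(* No pile went down by more than the smallest one, so the lowered position
   can only have grown. *)
rewrite Uval_long // (leq_trans _ (leq_trans long_x _)) //; first by rewrite mu ltnW.
apply: leq_bin2l; rewrite !yval_lower ltnS.
apply: (tetris_mono H0 Hsym Hmin Hk) => i; rewrite !ffunE mu.
by have [->|/ui] := eqVneq i c; [rewrite xc | have := min_x i]; lia.
Qed.

Lemma vval_lt x : 'C(yval H x, 2) < min_pile x -> vval H x < min_pile x.
Proof.
move=> short_x; rewrite /vval.
by have := leq_mod (min_pile x - 'C(yval H x, 2) - 1) (yval H x); lia.
Qed.

Lemma Uval_reach x z : z < U x -> exists2 x', move H x x' & U x' = z.
Proof.
have [p p0 zp] := triangular_interval z; case/andP: (zp) => Cz zC.
rewrite /Uval; case: (leqP (min_pile x) 'C(yval H x, 2)) => [long_x|short_x] lt_z.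
  have [lt_zm|ge_zm] := ltnP z (min_pile x); last by apply: reach_long; rewrite // ge_zm.
  have py : p < yval H x.
    by rewrite ltnNge; apply/negP => /(leq_bin2l 2); lia.
  by apply: (reach_short lt_zm zp (ltnW py)) => pE; rewrite -pE ltnn in py.
have lt_zm := ltn_trans lt_z (vval_lt short_x).
have y0 : 0 < yval H x by [].
apply: (reach_short lt_zm zp).
  rewrite leqNgt; apply/negP => /(leq_bin2l 2); rewrite binS2.
  by move: lt_z; rewrite /vval; have := ltn_pmod (min_pile x - 'C(yval H x, 2) - 1) y0; lia.
(* With [p = yval H x], a zero remainder would make [vval H x] equal to [z]. *)
move=> pE; rewrite pE in zC Cz *; move=> mod0; move: lt_z; rewrite /vval.
have -> : min_pile x - 'C(yval H x, 2) - 1 =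
          (min_pile x - z.+1) %/ yval H x * yval H x + (z - 'C(yval H x, 2)).
  by have := divn_eq (min_pile x - z.+1) (yval H x); lia.
by rewrite modnMDl modn_small; lia.
Qed.

Lemma Uval_move x x' : move H x x' -> U x' <> U x.
Proof.
move=> mv; case/andP: (mv) => /forallP le_x; set A := [set i | _] => AH.
have /card_gt0P[o _] : 0 < #|V| by lia.
have kA : k <= #|~: A| by have := Htf AH; have := cardsC A; lia.
have x'E i : i \in ~: A -> x' i = x i by rewrite !inE; have := le_x i; lia.
have le_m : min_pile x' <= min_pile x.
  have [[i xi] _] := min_pileP x o.
  by rewrite -xi; apply: leq_trans (min_pile_le x' i) (le_x i).
have mT' : min_pile x <= T x'.
  apply: (tetris_many H0 Hsym Hmin Hk kA) => i /x'E ->; exact: min_pile_le.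
have y'm : min_pile x - min_pile x' < yval H x'.
  rewrite yval_lower ltnS; apply: (tetris_many H0 Hsym Hmin Hk kA) => i /x'E x'i.
  by rewrite ffunE x'i; have := min_pile_le x i; lia.
have y_dec : min_pile x' = min_pile x -> yval H x' < yval H x.
  move=> mE; rewrite !yval_lower ltnS; apply: (move_tetris H0 Hsym Hmin Hk).
  apply: (moveI AH) => i; rewrite !ffunE mE inE => xi.
    by have := min_pile_le x' i; lia.
  by have := le_x i; lia.
(* If exactly one of the positions is short, its [vval] is below [min_pile x <= T x' < T x], so it
   differs from the Tetris value of the other. *)
rewrite /Uval; case: (leqP (min_pile x') _) => [_|short'];
  case: (leqP (min_pile x) _) => [_|short].
- by have := move_tetris H0 Hsym Hmin Hk mv; lia.
- by have := vval_lt short; lia.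
- by have := vval_lt short'; have := move_tetris H0 Hsym Hmin Hk mv; lia.
(* Equal values force equal [yval] and minima congruent modulo it; [y_dec] excludes equal minima,
   and [y'm] bounds their difference below the modulus. *)
rewrite /vval => /triangular_interval_inj[||yE modE]; try exact: ltn_pmod.
case: (ltngtP (min_pile x') (min_pile x)) => [lt_m|?|mE]; last 2 first.
- by lia.
- by have := y_dec mE; rewrite yE ltnn.
rewrite yE in modE short' y'm.
have /eqP := modE; rewrite eq_sym eqn_mod_dvd; last by lia.
by move=> /dvdn_leq; lia.
Qed.

Lemma grundy_Uval : JM H.
Proof.
move=> x; have [N] := ubnP (stones x); elim: N x => // N IH x; rewrite ltnS => leN.
have IHx x' : move H x x' -> grundy H x' = U x'.
  by move=> mv; apply: IH; apply: leq_trans (move_stones H0 mv) leN.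
have [noG reachG] := grundyP H0 x.
case: (ltngtP (grundy H x) (U x)) => // [/Uval_reach|/reachG] [x' mv E].
  by case: (noG x' mv); rewrite IHx.
by case: (Uval_move mv); rewrite -IHx.
Qed.

End MinimalTransversalFree.

(** * Necessity of the transversality conditions *)

Section Necessity.

Variables (V : finType) (H : {set {set V}}).

Hypothesis H0 : set0 \notin H.
Hypothesis HJM : JM H.

Local Notation T := (tetris H).
Local Notation U := (Uval H).

Lemma tetris_gt0 (x : {ffun V -> nat}) :
  (0 < T x) = [exists A in H, A \subset [set i | 0 < x i]].
Proof.
have [[p pp sz] maxp] := tetrisP H0 x.
apply/idP/existsP => [|[A /andP[AH /subsetP sub]]].
  case: p pp sz => [_ <- //|x' p /= /andP[/andP[_ AH] _] _ _].
  exists [set i | x' i < x i]; rewrite AH; apply/subsetP => i.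
  by rewrite !inE; apply: leq_ltn_trans.
apply: (maxp [:: unit_dec x A]); rewrite /= andbT; apply: unit_dec_move => // i /sub.
by rewrite inE.
Qed.

Lemma Uval_zero_pile (x : {ffun V -> nat}) o : x o = 0 -> U x = T x.
Proof. by move=> xo; rewrite /Uval (min_pile_eq xo). Qed.

Lemma edge_mem A : A \in H -> exists i, i \in A.
Proof. by move=> AH; apply/set0Pn; apply: contraNneq H0 => <-. Qed.

(* An edge that is a transversal would give a move from the all-ones position to a terminal
   one, while both have Uval 0. *)
Lemma JM_transversal_free : transversal_free H.
Proof.
move=> A AH trA; have [o oA] := edge_mem AH.
pose e : {ffun V -> nat} := [ffun=> 1].
have mv : move H e (unit_dec e A) by apply: unit_dec_move => // i _; rewrite ffunE.
have [noG _] := grundyP H0 e; case: (noG _ mv); rewrite !HJM.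
have -> : U e = 0.
  have eE : e = shift [ffun=> 0] 1 by apply/ffunP => i; rewrite !ffunE.
  have T0 : T [ffun=> 0] = 0.
    apply/eqP; rewrite eqn0Ngt tetris_gt0; apply/existsP => -[B /andP[BH /subsetP sub]].
    by have [i /sub] := edge_mem BH; rewrite inE ffunE.
  (* Here [yval] is 1 and the minimum 1 exceeds ['C(1, 2) = 0], so the value is a remainder modulo
     1. *)
  rewrite /Uval /vval eE (@yval_shift _ _ _ o) ?(@min_pile_shift _ _ o) ?ffunE //.
  by rewrite T0.
rewrite (@Uval_zero_pile _ o); last by rewrite !ffunE oA.
apply/eqP; rewrite eqn0Ngt tetris_gt0; apply/existsP => -[B /andP[BH /subsetP sub]].
have /set0Pn[i] := trA B BH; rewrite inE => /andP[iA /sub].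
by rewrite inE !ffunE iA.
Qed.

(* The indicator of S has positive value; a move to value 0 removes a
   transversal of the induced hypergraph. *)
Lemma JM_minimal_transversal_free : minimal_transversal_free H.
Proof.
split=> [|S /properP[_ [o _ oS]] /set0Pn[A0]]; first exact: JM_transversal_free.
rewrite inE => /andP[A0H /subsetP A0S] tfS.
pose x : {ffun V -> nat} := [ffun i => i \in S : nat].
have xo : x o = 0 by rewrite ffunE (negPf oS).
have Tx : 0 < T x.
  rewrite tetris_gt0; apply/existsP; exists A0; rewrite A0H; apply/subsetP => i /A0S iS.
  by rewrite inE ffunE iS.
have [_ reachG] := grundyP H0 x; rewrite HJM (Uval_zero_pile xo) in reachG.
have [x' /andP[/forallP le_x AH]] := reachG 0 Tx.
have x'o : x' o = 0 by have := le_x o; rewrite xo leqn0 => /eqP.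
rewrite HJM (Uval_zero_pile x'o) => Tx'.
apply: (tfS [set i | x' i < x i]).
  rewrite inE AH; apply/subsetP => i; rewrite inE ffunE.
  by case: (i \in S).
move=> B; rewrite inE => /andP[BH /subsetP BS]; apply/negP => /eqP disj.
suff : 0 < T x' by rewrite Tx'.
rewrite tetris_gt0; apply/existsP; exists B; rewrite BH; apply/subsetP => i iB.
rewrite inE ltnNge; apply/negP => x'i.
have : i \in [set i | x' i < x i] :&: B by rewrite !inE iB andbT ffunE BS.
by rewrite disj inE.
Qed.

End Necessity.

(** * Two-pile NIM *)

Section TwoPiles.

Variables (V : finType) (H : {set {set V}}) (c d : V).

Hypothesis H0 : set0 \notin H.
Hypothesis Hsym : symmetric_hypergraph H.
Hypothesis H1 : forall A, A \in H -> #|A| = 1.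
Hypothesis Hk : exists2 A, A \in H & #|A| = 1.
Hypothesis cd : c != d.
Hypothesis cdV : forall i, i != c -> i = d.

Definition piles a b : {ffun V -> nat} := [ffun i => if i == c then a else b].

Lemma pilesE (x : {ffun V -> nat}) : x = piles (x c) (x d).
Proof. by apply/ffunP => i; rewrite ffunE; case: eqVneq => [->|/cdV ->]. Qed.

Lemma piles_c a b : piles a b c = a.
Proof. by rewrite ffunE eqxx. Qed.

Lemma piles_d a b : piles a b d = b.
Proof. by rewrite ffunE eq_sym (negPf cd). Qed.

Lemma tetris_piles a b : tetris H (piles a b) = a + b.
Proof.
have geE t : (t <= tetris H (piles a b)) = (t <= minn a t + minn b t).
  rewrite (tetris_geE H0 Hsym (k := 1)) //; last by move=> A /H1 ->.
  rewrite /feasible mul1n (bigD1 c) //= (bigD1 d) 1?eq_sym //= big1 => [|i /andP[]].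
    by rewrite piles_c piles_d addn0.
  by move=> /cdV ->; rewrite eqxx.
have : a + b <= tetris H (piles a b) by rewrite geE; lia.
have : ((a + b).+1 <= tetris H (piles a b)) = false by rewrite geE; lia.
by lia.
Qed.

Lemma Uval_piles a b : Uval H (piles a b) =
  let m := minn a b in let y := ((a - m) + (b - m)).+1 in
  if m <= 'C(y, 2) then a + b else 'C(y, 2) + (m - 'C(y, 2) - 1) %% y.
Proof.
have mE : min_pile (piles a b) = minn a b.
  have [ab|ba] := leqP a b.
    apply: (@min_pile_eq _ _ c) => [|i]; first exact: piles_c.
    by rewrite ffunE; case: eqP.
  apply: (@min_pile_eq _ _ d) => [|i]; first exact: piles_d.
  by rewrite ffunE; case: eqP => // _; apply: ltnW.
have yE : yval H (piles a b) = ((a - minn a b) + (b - minn a b)).+1.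
  rewrite yval_lower -tetris_piles; congr (tetris H _).+1; apply/ffunP => i.
  by rewrite !ffunE mE; case: eqP.
by rewrite /Uval /vval mE yE tetris_piles.
Qed.

(** The position (1,3) has [Uval] 4, but its options (0,3), (1,2), (1,1), (1,0) have [Uval] 3, 3, 0,
    1, so 2 is missing. *)
Lemma two_piles_not_JM : ~ JM H.
Proof.
move=> HJM; have [_ reachG] := grundyP H0 (piles 1 3).
have [|x'] := reachG 2; first by rewrite HJM Uval_piles.
case/andP=> /forallP le_x AH; rewrite HJM (pilesE x') Uval_piles.
have := le_x c; have := le_x d; rewrite piles_c piles_d.
have [x'c|x'c] := posnP (x' c).
  have x'd : ~~ (x' d < 3).
    apply/negP => x'd; have := H1 AH; suff -> : [set i | x' i < piles 1 3 i] = [set c; d].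
      by rewrite cards2 cd.
    apply/setP => i; rewrite !inE; have [->|/cdV ->] := eqVneq i c.
      by rewrite piles_c x'c.
    by rewrite piles_d x'd eqxx.
  by rewrite x'c; case: (x' d) x'd => [|[|[|[|]]]].
by case: (x' c) x'c => [|[|]] //; case: (x' d) => [|[|[|[|]]]].
Qed.

End TwoPiles.

(** * Transversality conditions as conditions on edge sizes *)

Section MinimalSizes.

Variables (V : finType) (H : {set {set V}}).

Lemma exists_min_card : H != set0 -> exists k,
  (forall A, A \in H -> k <= #|A|) /\ exists2 A, A \in H & #|A| = k.
Proof.
case/set0Pn=> A0 A0H; case: (arg_minnP (fun A : {set V} => #|A|) A0H) => A AH minA.
by exists #|A|; split; last by exists A.
Qed.

Variable k : nat.

Hypothesis Hsym : symmetric_hypergraph H.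
Hypothesis Hmin : forall A, A \in H -> k <= #|A|.
Hypothesis Hk : exists2 A, A \in H & #|A| = k.

(** An edge that leaves fewer than [k] vertices outside meets every edge. *)
Lemma transversal_free_card : transversal_free H ->
  forall A, A \in H -> #|A| + k <= #|V|.
Proof using Hmin.
move=> tf A AH; rewrite leqNgt; apply/negP => lt_V; apply: (tf A AH) => B BH.
apply/negP => disj.
have : #|A :|: B| <= #|V| by apply: max_card.
by rewrite cardsU (eqP disj) cards0 subn0; have := Hmin BH; lia.
Qed.

(** Let [S] have [h] vertices. If no edge size lies in the window, each edge inside [S] leaves at
    least [k] vertices of [S] free; [k] of these form a disjoint edge, so [induced H S] would be
    transversal-free. *)
Lemma minimal_transversal_free_gap : minimal_transversal_free H ->
  forall h, k <= h < #|V| -> exists2 A, A \in H & #|A| <= h < #|A| + k.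
Proof using Hsym Hk.
move=> [_ mtf] h /andP[kh hV].
suff /existsP[A /andP[AH cA]] : [exists A in H, #|A| <= h < #|A| + k] by exists A.
apply: contraT; rewrite negb_exists_in => /forall_inP noA.
have [S _ cS] : exists2 S : {set V}, S \subset setT & #|S| = h.
  by apply: exists_subset_card; rewrite cardsT ltnW.
have kH (B : {set V}) : #|B| = k -> B \in H by apply: mem_card_min.
case: (mtf S).
- by rewrite properEcard subsetT cardsT cS.
- have [|B BS cB] := @exists_subset_card _ S k; first by rewrite cS.
  by apply/set0Pn; exists B; rewrite inE BS kH.
move=> A; rewrite inE => /andP[AH AS] trA.
have cA : #|A| + k <= h.
  by have := noA A AH; have := subset_leq_card AS; rewrite cS; lia.
have [|B] := @exists_subset_card _ (S :\: A) k.
  by rewrite cardsD (setIidPr AS) cS; lia.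
rewrite subsetD => /andP[BS disj] cB.
have : A :&: B != set0 by apply: trA; rewrite inE BS kH.
by rewrite setI_eq0 disjoint_sym disj.
Qed.

End MinimalSizes.

Theorem theorem1 (n : nat) (H : {set {set 'I_n}})
    (n_ge1 : 1 <= n) (H_neq0 : H != set0) (H_set0 : set0 \notin H)
    (H_sym : symmetric_hypergraph H) :
  JM H <-> minimal_transversal_free H /\ 3 <= n.
Proof.
have [k [Hmin Hk]] := exists_min_card H_neq0.
split=> [HJM|[mtf n_ge3]].
  have mtf := JM_minimal_transversal_free H_set0 HJM; split=> //.
  have [tf _] := mtf; have Htf := transversal_free_card Hmin tf.
  have k0 := min_card_gt0 H_set0 Hk; rewrite card_ord in Htf.
  rewrite leqNgt; apply/negP => n_lt3.
  (* Two disjoint edges need [2k <= n], so [n < 3] leaves only [k = 1], [n = 2] and singleton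
     edges. *)
  have H1 A : A \in H -> #|A| = 1 by move=> AH; have := Htf A AH; have := Hmin A AH; lia.
  have [A AH kA] := Hk; have := Htf A AH; have := Hmin A AH => ? ?.
  have n2 : n = 2 by lia.
  move: H_set0 H_sym H1 HJM AH {H_neq0 Hmin Hk mtf tf Htf n_ge1}; subst n.
  move=> H_set0 H_sym H1 HJM AH.
  apply: (@two_piles_not_JM _ _ ord0 ord_max) HJM => //; first by exists A; rewrite ?H1.
  by move=> i; rewrite -!val_eqE; case: i => [[|[|]]] // ? _; apply/val_inj.
have Htf := transversal_free_card Hmin mtf.1.
have Hgap := minimal_transversal_free_gap H_sym Hk mtf.
by apply: (grundy_Uval H_set0 H_sym Hmin Hk Htf Hgap); rewrite card_ord.
Qed.
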